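(* Two patterns $\sigma$ and $\tau$ are strong-c-forest-Wilf equivalent if and only if their forest cluster numbers are equal, i.e. $r_{n,m}(\sigma)=r_{n,m}(\tau)$ for all integers $n,m\ge 1$.
   Context: A forest on $[n]$ is an unordered rooted forest with $n$ vertices labeled bijectively by $[n]$; $F_n$ is the set of them. A consecutive instance of $\sigma\in\mathcal{S}_k$ in a labeled forest or tree is a sequence of vertices $v_1,\dots,v_k$ with $v_i$ the parent of $v_{i+1}$ for $1\le i\le k-1$ and labels in the same relative order as $\sigma$. Patterns $\sigma,\tau$ are strong-c-forest-Wilf equivalent if for all $n,m\ge 0$, the number of forests in $F_n$ with exactly $m$ consecutive instances of $\sigma$ equals that for $\tau$. For integers $m,n\ge 1$, an $m$-forest cluster of size $n$ with respect to $\sigma$ is a rooted tree with $n$ vertices with distinct positive integer labels together with exactly $m$ distinct highlighted consecutive instances of $\sigma$ such that every vertex belongs to some highlighted instance, and the vertex set cannot be partitioned into two nonempty sets such that each highlighted instance lies entirely in one of them. The forest cluster numbers $r_{n,m}(\sigma)$ ($n,m\ge 1$) count the $m$-forest clusters with respect to $\sigma$ whose label set is $[n]$ (two clusters differ if the labeled trees or the sets of highlighted instances differ). *)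

(* Defs.v *)
From HB Require Import structures.
From mathcomp Require Import all_boot all_fingroup.

Set Implicit Arguments.
Unset Strict Implicit.
Unset Printing Implicit Defensive.

(* A vertex is identified with its label, and the label set [n] is represented
   by 'I_n, i.e. {0, ..., n-1}: only the relative order of labels matters.
   An unordered rooted forest is its parent function, with value None exactly
   at the roots. *)
Definition parent_map (n : nat) := {ffun 'I_n -> option 'I_n}.

(* Acyclicity: on n vertices, climbing n times from any vertex passes a root. *)
Definition is_forest (n : nat) (p : parent_map n) : bool :=
  [forall v : 'I_n, iter n (obind p) (Some v) == None].

Definition is_tree (n : nat) (p : parent_map n) : bool :=
  is_forest p && (#|[set v : 'I_n | p v == None]| == 1).

Definition is_instance (k n : nat) (sigma : 'S_k) (p : parent_map n)
    (t : k.-tuple 'I_n) : bool :=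
  [forall i : 'I_k, forall j : 'I_k,
     (j == i.+1 :> nat) ==> (p (tnth t j) == Some (tnth t i))]
  && [forall i : 'I_k, forall j : 'I_k,
        (tnth t i < tnth t j) == (sigma i < sigma j)].

Definition instances (k n : nat) (sigma : 'S_k) (p : parent_map n) :
    {set k.-tuple 'I_n} :=
  [set t | is_instance sigma p t].

Definition num_forests (k : nat) (sigma : 'S_k) (n m : nat) : nat :=
  #|[set p : parent_map n | is_forest p & #|instances sigma p| == m]|.

Definition strong_c_forest_Wilf_equivalent (k l : nat)
    (sigma : 'S_k) (tau : 'S_l) : Prop :=
  forall n m : nat, num_forests sigma n m = num_forests tau n m.

Definition covers_vertices (k n : nat) (H : {set k.-tuple 'I_n}) : bool :=
  [forall v : 'I_n, exists t in H, v \in t].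

Definition splits (k n : nat) (H : {set k.-tuple 'I_n}) (A : {set 'I_n}) :
    bool :=
  [&& A != set0, ~: A != set0
    & [forall t in H, (t \subset A) || (t \subset ~: A)]].

(* Clusters with label set [n]: a labeled tree together with its set H of
   highlighted instances. *)
Definition is_forest_cluster (k n : nat) (sigma : 'S_k) (m : nat)
    (p : parent_map n) (H : {set k.-tuple 'I_n}) : bool :=
  [&& is_tree p, H \subset instances sigma p, #|H| == m,
      covers_vertices H & ~~ [exists A : {set 'I_n}, splits H A]].

Definition forest_cluster_number (k : nat) (sigma : 'S_k) (n m : nat) : nat :=
  #|[set c : parent_map n * {set k.-tuple 'I_n}
      | is_forest_cluster sigma m c.1 c.2]|.

(* Main.v *)
(* Expand (1 + x)^(number of instances) over the sets H of highlighted
   instances. In a forest with highlights H, vertices sharing a highlighted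
   instance generate a partition P of [n] whose blocks carry clusters (or are
   single unmarked vertices); what remains is the choice, for each block, of
   the parent of its root. The number of such choices depends on P only, so

     F_n(1 + x) = \sum_P W(P) \prod_(B in P) C_|B|(x),

   where F_n counts forests by instances and C_n counts clusters by highlights.
   Hence the C_n determine the F_n; conversely C_n occurs only in the term of
   the one-block partition, so it is recovered from F_n by induction on n. *)
Require Import Defs.
From mathcomp Require Import all_boot all_fingroup all_algebra.
Import GRing.Theory Num.Theory.

Set Implicit Arguments.
Unset Strict Implicit.
Unset Printing Implicit Defensive.

(** * Acyclic parent functions *)

Section Acyclic.

Variable V : finType.
Implicit Types (o : option V) (A S : {set V}).

Definition avoids o A := if o is Some u then u \notin A else true.

Lemma avoidsPn o A : reflect (exists2 u, o = Some u & u \in A) (~~ avoids o A).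
Proof.
apply: (iffP idP) => [|[u -> uA] /=]; last by rewrite uA.
by case: o => //= u; rewrite negbK; exists u.
Qed.

(** Acyclicity through sets instead of iterated climbing: no nonempty set is closed under taking
    parents. In this form it passes directly to restrictions and to gluings. *)
Definition acyclic (p : V -> option V) :=
  [forall S : {set V}, (S != set0) ==> [exists v in S, avoids (p v) S]].

Lemma acyclicP (p : V -> option V) :
  reflect (forall S, S != set0 -> exists2 v, v \in S & avoids (p v) S)
          (acyclic p).
Proof.
apply: (iffP forallP) => [H S S0|H S]; first exact/exists_inP/(implyP (H S)).
by apply/implyP => /H/exists_inP.
Qed.

Lemma acyclic_sub (p q : V -> option V) :
  (forall u v, q v = Some u -> p v = Some u) -> acyclic p -> acyclic q.
Proof.
move=> qp /acyclicP acp; apply/acyclicP => S /acp[v vS pv]; exists v => //.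
by case E: (q v) => [u|] //=; rewrite (qp _ _ E) in pv.
Qed.

End Acyclic.

(** A nonempty set closed under parents would let a climb go on forever. Conversely, let [S i] be
    the set of vertices that survive [i] climbs. While nonempty it loses a vertex at each step,
    namely one whose parent is missing or outside [S i], so [S n] is empty. *)
Lemma is_forestE (n : nat) (p : parent_map n) : is_forest p = acyclic p.
Proof.
have iterN i : iter i (obind p) None = None by elim: i => //= i ->.
apply/forallP/acyclicP => [Fp S /set0Pn[v vS]|acp v].
  apply/exists_inP; apply: contraT => /exists_inPn closedS.
  have: forall i u, u \in S -> iter i (obind p) (Some u) != None.
    elim=> // i IHi u /closedS/avoidsPn[w pu wS].
    by rewrite iterSr /= pu IHi.
  by move=> /(_ n v vS); rewrite (eqP (Fp v)).
pose S i := [set u : 'I_n | iter i (obind p) (Some u) != None].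
have sS i : S i.+1 \subset S i.
  apply/subsetP => u; rewrite !inE; apply: contraNneq => /= ui.
  by rewrite ui.
have cS i : i <= n -> #|S i| <= n - i.
  elim: i => [|i IHi] lin.
    by rewrite subn0 (leq_trans (max_card _)) ?card_ord.
  case: (eqVneq (S i) set0) => [S0|/acp[u uS pu]].
    by have := sS i; rewrite S0 subset0 => /eqP->; rewrite cards0.
  rewrite subnS -ltnS prednK ?subn_gt0 //.
  apply: leq_trans (IHi (ltnW lin)); apply: proper_card.
  rewrite properE sS; apply/subsetPn; exists u => //.
  rewrite inE iterSr /=; case: (p u) pu => [w|]; last by rewrite iterN.
  by rewrite /= inE.
have := cS n (leqnn n); rewrite subnn leqn0 cards_eq0 => /eqP Sn0.
apply: contraT => vn; have : v \in S n by rewrite inE.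
by rewrite Sn0 inE.
Qed.

(** * Marked forests and clusters on a finite vertex set *)

Section Clusters.

(** The order of labels enters only through the predicate [ok]. Length [k.+1] gives each mark a
    first vertex, which later tells the block of the mark. *)
Variables (k : nat) (V : finType) (ok : pred (k.+1.-tuple V)).

Local Notation pmap := {ffun V -> option V}.
Local Notation hset := {set k.+1.-tuple V}.
Implicit Types (p q : pmap) (H : hset) (A B S : {set V}) (P : {set {set V}}).
Implicit Types (t : k.+1.-tuple V).

Definition chain p t :=
  [forall i : 'I_k.+1, forall j : 'I_k.+1,
     (j == i.+1 :> nat) ==> (p (tnth t j) == Some (tnth t i))].

Lemma chainP p t :
  reflect (forall i j : 'I_k.+1, j = i.+1 :> nat ->
             p (tnth t j) = Some (tnth t i)) (chain p t).
Proof.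
apply: (iffP forallP) => [H i j /eqP ij|H i].
  exact/eqP/(implyP (forallP (H i) j)).
by apply/forallP => j; apply/implyP => /eqP ij; apply/eqP/H.
Qed.

Definition occurrences p : hset := [set t | chain p t && ok t].

Definition respects H A := [forall t in H, (t \subset A) || (t \subset ~: A)].

(** The indivisibility condition of clusters, stated positively: every cut compatible with the marks
    leaves [B] on one side. *)
Definition connected H B :=
  [forall A : {set V}, respects H A ==> (B \subset A) || (B \subset ~: A)].

Lemma connectedP H B :
  reflect (forall A, respects H A -> B \subset A \/ B \subset ~: A)
          (connected H B).
Proof.
apply: (iffP forallP) => [C A /(implyP (C A))/orP //|C A].
by apply/implyP => /C/orP.
Qed.

Definition supported q B :=
  [forall v, if q v is Some u then (v \in B) && (u \in B) else true].

Lemma supportedP q B :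
  reflect (forall u v, q v = Some u -> v \in B /\ u \in B) (supported q B).
Proof.
apply: (iffP forallP) => [C u v quv|C v].
  by have := C v; rewrite quv => /andP.
by case E: (q v) => [u|] //; apply/andP/C.
Qed.

(* Marked forests living on the vertex set B alone: the default value None
   stands for both the roots and the vertices outside B. *)
Definition cluster_on B (c : pmap * hset) :=
  [&& B != set0, supported c.1 B, acyclic c.1, c.2 \subset occurrences c.1,
      [forall t in c.2, t \subset B] & connected c.2 B].

Lemma chain_respects p t A : chain p t ->
  (forall u v, p v = Some u -> (u \in A) = (v \in A)) ->
  (t \subset A) || (t \subset ~: A).
Proof.
move=> /chainP ct cA.
have tA i : (tnth t i \in A) = (tnth t ord0 \in A).
  case: i => i; elim: i => [|i IHi] lti.
    by congr (tnth t _ \in A); apply: val_inj.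
  by rewrite -(IHi (ltnW lti)); apply/esym/cA/ct.
case E: (tnth t ord0 \in A); rewrite E in tA; apply/orP; [left|right];
  by apply/subsetP => _ /tnthP[i ->]; rewrite ?inE tA.
Qed.

(** Acyclicity supplies a root [r]. The set of vertices with [r] as ancestor contains a vertex
    exactly when it contains its parent, so no mark crosses it, and connectedness forces all of [B]
    into it. Hence any root in [B] is [r]. *)
Lemma cluster_root B q H : cluster_on B (q, H) ->
  exists2 r, r \in B & forall v, v \in B -> (q v == None) = (v == r).
Proof.
case/and5P=> /= B0 /supportedP sq /acyclicP acq Hq /andP[HB /connectedP cH].
have [r rB qr] := acq B B0.
have {}qr : q r = None.
  by case E: (q r) qr => [u|] //= /negP[]; case: (sq _ _ E).
exists r => // v vB; apply/eqP/eqP => [qv|-> //].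
pose e := [rel x y | q x == Some y].
pose A := [set x | connect e x r].
have rA : r \in A by rewrite inE connect0.
have /cH[/subsetP/(_ v vB)|/subsetP/(_ r rB)] : respects H A; last first.
- by rewrite inE rA.
- rewrite inE => /connectP[[|w s] /=]; first by move=> _ ->.
  by rewrite qv.
apply/forall_inP => t /(subsetP Hq); rewrite inE => /andP[ct _].
apply: chain_respects ct _ => x y qy; rewrite !inE; apply/idP/idP => [cx|].
  by apply: connect_trans cx; apply: connect1; rewrite /= qy.
case/connectP => [[|w s] /=]; first by move=> _ yr; rewrite -yr qr in qy.
rewrite qy => /andP[/eqP[->] ws] rs.
by apply/connectP; exists s.
Qed.

(** * Blocks: the connected components of the marks *)

Definition joined H := [rel u v | [exists t in H, (u \in t) && (v \in t)]].

Definition blocks H := equivalence_partition (connect (joined H)) setT.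

Lemma joined_equiv H :
  {in setT & &, equivalence_rel (connect (joined H))}.
Proof.
move=> x y z _ _ _; split; first exact: connect0.
move=> cxy; apply: same_connect cxy z; apply: sym_connect_sym => u v.
by apply: eq_existsb => t; rewrite [(u \in t) && _]andbC.
Qed.

Lemma blocks_partition H : partition (blocks H) setT.
Proof. exact: equivalence_partitionP (joined_equiv H). Qed.

Lemma pblock_blocks H x y :
  (y \in pblock (blocks H) x) = connect (joined H) x y.
Proof.
by rewrite pblock_equivalence_partition ?inE //; apply: joined_equiv.
Qed.

Lemma pblockP P v : partition P setT -> pblock P v \in P /\ v \in pblock P v.
Proof.
move=> pP; have vP : v \in cover P by rewrite (cover_partition pP) inE.
by rewrite pblock_mem // mem_pblock.
Qed.

Lemma block_pblock P B v : partition P setT -> B \in P -> v \in B ->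
  pblock P v = B.
Proof. by move=> /partition_trivIset tP; apply: def_pblock. Qed.

Definition marks_in H B : hset := [set t in H | t \subset B].

Lemma blocks_sub H t v : t \in H -> v \in t -> t \subset pblock (blocks H) v.
Proof.
move=> tH vt; apply/subsetP => u ut; rewrite pblock_blocks.
by apply/connect1/exists_inP; exists t; rewrite ?vt.
Qed.

Lemma connect_respects H A x y :
  respects H A -> connect (joined H) x y -> (x \in A) = (y \in A).
Proof.
move=> /forall_inP rA; apply: closed_connect => {x y} u v /=.
case/exists_inP => t /rA tA /andP[ut vt].
case/orP: tA => /subsetP tA; first by rewrite !tA.
by have := tA u ut; have := tA v vt; rewrite !inE => /negPf-> /negPf->.
Qed.

Lemma respects_blocks H x y A :
  respects H A -> y \in pblock (blocks H) x -> (x \in A) = (y \in A).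
Proof. by rewrite pblock_blocks; apply: connect_respects. Qed.

(** A cut [A] compatible with the marks inside [B] may cut other marks, so it is replaced by
    [A :&: B]. This respects all of [H], because a mark not inside [B] is disjoint from [B]. *)
Lemma blocks_connected H B : B \in blocks H -> connected (marks_in H B) B.
Proof.
move=> BP; have pP := blocks_partition H; apply/connectedP => A /forall_inP rA.
have rAB : respects H (A :&: B).
  apply/forall_inP => t tH.
  case: (boolP (t \subset B)) => [tB|].
    have := rA t; rewrite inE tH tB => /(_ isT)/orP[]tA.
      apply/orP; left; apply/subsetP => u ut.
      by rewrite inE (subsetP tA _ ut) (subsetP tB).
    by rewrite setCI (subset_trans tA (subsetUl _ _)) orbT.
  case/subsetPn => u ut uB; apply/orP; right.
  rewrite setCI; apply: subset_trans (subsetUr _ _).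
  apply/subsetP => w wt; rewrite inE; apply: contra uB => wB.
  by rewrite -(block_pblock pP BP wB) (subsetP (blocks_sub tH wt)).
have [v vB] : exists v, v \in B.
  apply/set0Pn; apply: contraTneq BP => ->; by case/and3P: pP.
have BE u : u \in B -> (v \in A :&: B) = (u \in A :&: B).
  by move=> uB; apply: respects_blocks rAB _; rewrite (block_pblock pP BP vB).
case E: (v \in A :&: B); rewrite E in BE; [left|right]; apply/subsetP => u uB;
  by have := BE u uB; rewrite !inE uB andbT => <-.
Qed.

(** Marks inside single parts keep a component from leaving its part; connectedness keeps a part
    from holding two components. This recovers the partition from a glued forest. *)
Lemma blocks_eq H P : partition P setT ->
  (forall t, t \in H -> exists2 B, B \in P & t \subset B) ->
  (forall B, B \in P -> connected (marks_in H B) B) ->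
  blocks H = P.
Proof.
move=> pP HP cP; rewrite -(equivalence_partition_pblock pP).
rewrite /blocks /equivalence_partition /preim_partition.
suff E : connect (joined H) =2 (fun x y => y \in pblock P x).
  apply: eq_imset => x; apply/setP => y; rewrite !inE; exact: E.
move=> x y; have [xP xx] := pblockP x pP.
apply/idP/idP => [cxy|yx].
  rewrite -(connect_respects (A := pblock P x) _ cxy) //.
  apply/forall_inP => t /HP[B BP tB]; case: (eqVneq B (pblock P x)) => [<-|nB].
    by rewrite tB.
  apply/orP; right; apply: subset_trans tB _.
  rewrite -disjoints_subset; exact: (trivIsetP (partition_trivIset pP)).
(* The component of [x] is itself a compatible cut, so it contains the whole part of [x]. *)
pose A := [set z | connect (joined H) x z].
have xA : x \in A by rewrite inE connect0.
have /(connectedP _ _ (cP _ xP))[/subsetP/(_ y yx)|/subsetP/(_ x xx)] :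
    respects (marks_in H (pblock P x)) A; last 2 first.
- by rewrite inE.
- by rewrite inE xA.
apply/forall_inP => t; rewrite inE => /andP[tH _].
have tE u v : u \in t -> v \in t -> u \in A -> v \in A.
  rewrite !inE => ut vt xu; apply: connect_trans xu _.
  by apply/connect1/exists_inP; exists t; rewrite ?ut.
case: (boolP (t \subset A)) => //= /subsetPn[u ut uA].
by apply/subsetP => v vt; rewrite inE; apply: contra uA; apply: tE.
Qed.

Lemma marks_inS H B : marks_in H B \subset H.
Proof. by apply/subsetP => t; rewrite inE => /andP[]. Qed.

(** Marks are sorted by the part that contains their first vertex. *)
Lemma card_marks_in H P : partition P setT ->
  (forall t, t \in H -> exists2 B, B \in P & t \subset B) ->
  #|H| = \sum_(B in P) #|marks_in H B|.
Proof.
move=> pP HP; pose b t := pblock P (tnth t ord0).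
rewrite -sum1_card (partition_big b (mem P)) /=; last first.
  by move=> t _; have [] := pblockP (tnth t ord0) pP.
apply: eq_bigr => B BP; rewrite sum1dep_card; apply: eq_card => t; rewrite !inE.
case tH: (t \in H) => //=.
have [B' B'P tB'] := HP t tH; have tB'0 := subsetP tB' _ (mem_tnth ord0 t).
rewrite /b (block_pblock pP B'P tB'0); apply/eqP/idP => [<- //|tB].
have tB0 := subsetP tB _ (mem_tnth ord0 t).
by rewrite -(block_pblock pP B'P tB'0) (block_pblock pP BP tB0).
Qed.

(** * Cutting a forest into blocks and gluing it back *)

Definition restrict p B : pmap :=
  [ffun v => if (v \in B) && ~~ avoids (p v) B then p v else None].

Lemma restrict_Some p B u v :
  restrict p B v = Some u <-> [/\ v \in B, u \in B & p v = Some u].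
Proof.
rewrite ffunE; split=> [|[-> uB ->] /=]; last by rewrite uB.
case: ifP => // /andP[-> /avoidsPn[w -> wB]] [<-].
by split.
Qed.

(* How the blocks of P hang below one another: e B is the parent of the root
   of the tree on B. Which vertex is that root plays no role, which is why the
   number of linkings does not depend on the pattern. *)
Definition linking P (e : {ffun {set V} -> option V}) :=
  [forall B, (B \notin P) ==> (e B == None)] &&
  [forall D : {set {set V}}, (D \subset P) && (D != set0) ==>
     [exists B in D, avoids (e B) (cover D)]].

Lemma linkingP P (e : {ffun {set V} -> option V}) :
  reflect ((forall B, B \notin P -> e B = None) /\
           forall D : {set {set V}}, D \subset P -> D != set0 ->
             exists2 B, B \in D & avoids (e B) (cover D))
          (linking P e).
Proof.
apply: (iffP andP) => -[e0 eD]; split.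
- by move=> B BP; apply/eqP/(implyP (forallP e0 B)).
- by move=> D DP D0; apply/exists_inP/(implyP (forallP eD D)); rewrite DP.
- by apply/forallP => B; apply/implyP => /e0->.
- by apply/forallP => D; apply/implyP => /andP[DP D0]; apply/exists_inP/eD.
Qed.

Definition no_cluster : pmap * hset := ([ffun=> None], set0).

Definition marked_forest (c : pmap * hset) :=
  acyclic c.1 && (c.2 \subset occurrences c.1).

Local Notation links := {ffun {set V} -> option V}.
Local Notation clusters := {ffun {set V} -> pmap * hset}.

(** A vertex keeps its parent from the cluster on its block; the root of the cluster receives the
    link of the block. *)
Definition glue P (x : links * clusters) : pmap * hset :=
  ([ffun v => let B := pblock P v in
              if (x.2 B).1 v is Some u then Some u else x.1 B],
   \bigcup_(B in P) (x.2 B).2).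

(** The link of a block is the parent, in the whole forest, of the vertex that becomes its root.
    Fixed values outside [P] make the data unique, as a bijection requires. *)
Definition unglue P (c : pmap * hset) : links * clusters :=
  ([ffun B => if B \in P then
                if [pick v in B | restrict c.1 B v == None] is Some r
                then c.1 r else None
              else None],
   [ffun B => if B \in P then (restrict c.1 B, marks_in c.2 B)
              else no_cluster]).

(** * The gluing bijection for a fixed partition *)

Section FixedBlocks.

Variable P : {set {set V}}.
Hypothesis pP : partition P setT.

(** A [pfamily] is the index set that arises when a product of sums is expanded. *)
Definition glueable (x : links * clusters) :=
  linking P x.1 && (x.2 \in pfamily no_cluster (mem P) cluster_on).

Lemma glueableP (x : links * clusters) :
  reflect [/\ linking P x.1, forall B, B \notin P -> x.2 B = no_cluster
            & forall B, B \in P -> cluster_on B (x.2 B)]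
          (glueable x).
Proof.
apply: (iffP andP) => [[-> /pfamilyP[sx cx]]|[-> x0 cx]]; split=> //.
  by move=> B; apply: contraNeq => xB; apply: (subsetP sx).
apply/pfamilyP; split=> //; apply/subsetP => B.
by apply: contraR => /x0 ->.
Qed.

Lemma cluster_of_blocks p H B : marked_forest (p, H) -> blocks H = P ->
  B \in P -> cluster_on B (restrict p B, marks_in H B).
Proof.
case/andP=> /= acp Hp bH BP; apply/and5P; split=> /=.
- by apply: contraTneq BP => ->; case/and3P: pP.
- by apply/supportedP => u v /restrict_Some[].
- by apply: acyclic_sub acp => u v /restrict_Some[].
- apply/subsetP => t; rewrite !inE => /andP[tH tB].
  have := subsetP Hp t tH; rewrite inE => /andP[/chainP ct ->].
  rewrite andbT; apply/chainP => i j /ct E; apply/restrict_Some.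
  by split=> //; apply: (subsetP tB); apply: mem_tnth.
apply/andP; split; first by apply/forall_inP => t; rewrite inE => /andP[].
by apply: blocks_connected; rewrite bH.
Qed.

(** The choice made in [unglue] is unambiguous because a cluster has only one root. *)
Lemma unglue_link p H B r : marked_forest (p, H) -> blocks H = P ->
  B \in P -> r \in B -> restrict p B r = None -> (unglue P (p, H)).1 B = p r.
Proof.
move=> mf bH BP rB rN; rewrite ffunE BP.
have [s sB rootB] := cluster_root (cluster_of_blocks mf bH BP).
case: pickP => [v /andP[vB]|/(_ r)]; last by rewrite rB rN.
by rewrite rootB // => /eqP->; move/eqP: rN; rewrite rootB // => /eqP->.
Qed.

Lemma unglue_cluster p H B : B \in P ->
  (unglue P (p, H)).2 B = (restrict p B, marks_in H B).
Proof. by move=> BP; rewrite ffunE BP. Qed.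

Lemma unglue_glueable c : marked_forest c -> blocks c.2 = P ->
  glueable (unglue P c).
Proof.
case: c => p H mf /= bH; apply/glueableP; split; last 2 first.
- by move=> B BP; rewrite ffunE (negPf BP).
- by move=> B BP; rewrite ffunE BP; apply: cluster_of_blocks.
apply/linkingP; split=> [B BP|D DP D0]; first by rewrite ffunE (negPf BP).
apply/exists_inP; apply: contraT => /exists_inPn eD.
have /andP[/= /acyclicP acp _] := mf.
(* A vertex whose parent leaves the union of [D] also leaves its own block, so it is the root there
   and its parent is the link of the block. *)
have [|v /bigcupP[B BD vB]] := acp (cover D).
  case/set0Pn: D0 => B BD.
  have [r rB _] := cluster_root (cluster_of_blocks mf bH (subsetP DP B BD)).
  by apply/set0Pn; exists r; apply/bigcupP; exists B.
apply: contraTT => _.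
case E: (restrict p B v) => [u|].
  case/restrict_Some: E => _ uB ->; rewrite /= negbK.
  by apply/bigcupP; exists B.
by rewrite -(unglue_link mf bH (subsetP DP B BD) vB E); apply: eD.
Qed.

Lemma unglueK c : marked_forest c -> blocks c.2 = P -> glue P (unglue P c) = c.
Proof.
case: c => p H mf /= bH; congr pair.
  apply/ffunP => v; rewrite ffunE.
  have [BP vB] := pblockP v pP; cbv zeta; rewrite unglue_cluster //.
  case E: (restrict _ _ _) => [u|]; first by case/restrict_Some: E.
  exact: (unglue_link mf bH).
apply/setP => t; apply/bigcupP/idP => [[B BP]|tH].
  by rewrite ffunE BP; apply: (subsetP (marks_inS H B)).
exists (pblock P (tnth t ord0)); have [BP vB] := pblockP (tnth t ord0) pP => //.
by rewrite ffunE BP inE tH -bH blocks_sub // mem_tnth.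
Qed.

Lemma marks_in_glue x B : glueable x -> B \in P ->
  marks_in (glue P x).2 B = (x.2 B).2.
Proof.
case/glueableP => _ _ cx BP; apply/setP => t; rewrite inE.
apply/andP/idP => [[/bigcupP[B' B'P tB'] tB]|tB]; last first.
  split; first by apply/bigcupP; exists B.
  by have /and5P[_ _ _ _ /andP[/forall_inP/(_ t tB)]] := cx B BP.
have /and5P[_ _ _ _ /andP[/forall_inP/(_ t tB') sB' _]] := cx B' B'P.
have h := mem_tnth ord0 t.
rewrite -(block_pblock pP BP (subsetP tB _ h)).
by rewrite (block_pblock pP B'P (subsetP sB' _ h)).
Qed.

Lemma glue_sub x t : glueable x -> t \in (glue P x).2 ->
  exists2 B, B \in P & t \subset B.
Proof.
case/glueableP => _ _ cx /bigcupP[B BP tB]; exists B => //.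
by have /and5P[_ _ _ _ /andP[/forall_inP/(_ t tB)]] := cx B BP.
Qed.

Lemma glue_blocks x : glueable x -> blocks (glue P x).2 = P.
Proof.
move=> gx; apply: blocks_eq => // [t|B BP]; first exact: glue_sub.
rewrite marks_in_glue //; have /glueableP[_ _ cx] := gx.
by have /and5P[_ _ _ _ /andP[]] := cx B BP.
Qed.

(** Acyclicity is used on two levels. Among the parts meeting [S], some [B] has a link avoiding them
    all; inside [B :&: S], some vertex has no cluster parent in that set. Its glued parent is either
    in [B] but outside [S], or the link, if there is one. *)
Lemma glue_marked_forest x : glueable x -> marked_forest (glue P x).
Proof.
case/glueableP => /linkingP[_ ex] _ cx; apply/andP; split; last first.
  apply/subsetP => t /bigcupP[B BP tB].
  have /and5P[_ _ _ + /andP[/forall_inP/(_ t tB) sB _]] := cx B BP.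
  move=> /subsetP/(_ t tB).
  rewrite !inE => /andP[/chainP ct ->]; rewrite andbT; apply/chainP => i j ij.
  have jB := subsetP sB _ (mem_tnth j t).
  by rewrite ffunE (block_pblock pP BP jB) /= (ct _ _ ij).
apply/acyclicP => S /set0Pn[v0 v0S].
pose D := [set B in P | B :&: S != set0].
have DP : D \subset P by apply/subsetP => B; rewrite inE => /andP[].
have SD v : v \in S -> v \in cover D.
  move=> vS; have [BP vB] := pblockP v pP; apply/bigcupP.
  exists (pblock P v) => //; rewrite inE BP.
  by apply/set0Pn; exists v; rewrite inE vB.
have [|B] := ex D DP.
  by have /bigcupP[B BD _] := SD _ v0S; apply/set0Pn; exists B.
rewrite inE => /andP[BP BS0] eB.
have /and5P[_ /supportedP sB /acyclicP acB _ _] := cx B BP.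
have [v] := acB _ BS0; rewrite inE => /andP[vB vS] qv; exists v => //.
rewrite ffunE (block_pblock pP BP vB) /=.
case E: ((x.2 B).1 v) qv => [u|] /= => [|_].
  by have [_ uB] := sB _ _ E; rewrite inE uB.
by case: (x.1 B) eB => //= u; apply: contra => /SD.
Qed.

Lemma glueK x : glueable x -> unglue P (glue P x) = x.
Proof.
move=> gx; have /glueableP[/linkingP[e0 eD] f0 cx] := gx.
(* The linking condition for a single block says that its link leaves it. Otherwise restricting the
   glued map to [B] would keep the link as an extra edge. *)
have eB B u : B \in P -> x.1 B = Some u -> u \notin B.
  move=> BP E; have [||C] := eD [set B]; first by rewrite sub1set.
    by apply/set0Pn; exists B; rewrite inE.
  by rewrite inE => /eqP->; rewrite E /= /cover big_set1.
have fB B : B \in P -> restrict (glue P x).1 B = (x.2 B).1.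
  move=> BP; have /and5P[_ /supportedP sB _ _ _] := cx B BP.
  apply/ffunP => v; case E: ((x.2 B).1 v) => [u|].
    have [vB uB] := sB _ _ E; apply/restrict_Some; split=> //.
    by rewrite ffunE (block_pblock pP BP vB) /= E.
  case E': (restrict _ _ _) => [u|] //; case/restrict_Some: E' => vB uB.
  rewrite ffunE (block_pblock pP BP vB) /= E => /(eB _ _ BP).
  by rewrite uB.
case: x gx e0 eD f0 cx eB fB => e f /= gx e0 eD f0 cx eB fB.
congr pair; apply/ffunP => B; rewrite ffunE.
  case: ifPn => BP; last by rewrite e0.
  have [r rB rootB] := cluster_root (cx B BP).
  case: pickP => [v|/(_ r)]; last by rewrite rB fB // rootB // eqxx.
  rewrite fB // => /andP[vB /eqP qv].
  by rewrite ffunE (block_pblock pP BP vB) /= qv.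
case: ifPn => BP; last by rewrite f0.
by rewrite fB // marks_in_glue //; case: (f B).
Qed.

End FixedBlocks.

(** * Generating functions over marked forests *)

Section Weights.

Local Open Scope ring_scope.
Variables (R : comNzRingType) (x : R).

Definition cluster_weight B : R := \sum_(c | cluster_on B c) x ^+ #|c.2|.

Lemma sum_subsets (T : finType) (A : {set T}) :
  (1 + x) ^+ #|A| = \sum_(H : {set T} | H \subset A) x ^+ #|H|.
Proof.
(* With the product taken over all of [T], subsets not inside [A] pick up a factor 0. *)
have -> : (1 + x) ^+ #|A| = \prod_(i : T) ((if i \in A then x else 0) + 1).
  rewrite -prodr_const [RHS](bigID (mem A)) /= [X in _ * X]big1 ?mulr1.
    by apply: eq_bigr => i ->; rewrite addrC.
  by move=> i /negPf->; rewrite add0r.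
rewrite bigA_distr [RHS]big_mkcond; apply: eq_bigr => H _.
rewrite -big_mkcond /=; case: ifPn => [/subsetP HA|/subsetPn[i iH iA]].
  by rewrite -prodr_const; apply: eq_bigr => i /HA->.
by rewrite (bigD1 i) //= (negPf iA) mul0r.
Qed.

Lemma sum_marked_forests :
  \sum_(p : pmap | acyclic p) (1 + x) ^+ #|occurrences p| =
  \sum_(c | marked_forest c) x ^+ #|c.2|.
Proof.
under eq_bigr => p _ do rewrite sum_subsets.
by rewrite pair_big_dep.
Qed.

Lemma glue_weight P y : partition P setT -> glueable P y ->
  x ^+ #|(glue P y).2| = \prod_(B in P) x ^+ #|(y.2 B).2|.
Proof.
move=> pP gy; rewrite (card_marks_in pP) => [|t]; last exact: glue_sub.
by rewrite expr_sum; apply: eq_bigr => B BP; rewrite marks_in_glue.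
Qed.

Lemma sum_forests_blocks :
  \sum_(p : pmap | acyclic p) (1 + x) ^+ #|occurrences p| =
  \sum_(P | partition P [set: V])
     #|linking P|%:R * \prod_(B in P) cluster_weight B.
Proof.
rewrite sum_marked_forests.
rewrite (partition_big (fun c : pmap * hset => blocks c.2)
                       (fun P => partition P [set: V])) /=; last first.
  by move=> c _; apply: blocks_partition.
(* Marked forests with blocks [P] are replaced by pairs of a linking and a family of clusters. *)
apply: eq_bigr => P pP; rewrite (reindex_onto (glue P) (unglue P)) /=;
    last first.
  by move=> c /andP[mf /eqP bc]; apply: unglueK.
rewrite (eq_bigl (glueable P)) => [|y]; last first.
  apply/andP/idP => [[/andP[mf /eqP bc] /eqP<-]|gy].
    exact: unglue_glueable.
  by rewrite glue_marked_forest // glue_blocks // glueK ?eqxx.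
rewrite (eq_bigr (fun y : links * clusters =>
  \prod_(B in P) x ^+ #|(y.2 B).2|)); last first.
  by move=> y; apply: glue_weight.
(* The product of sums becomes a sum over families. The weight ignores the linking, so summing over
   linkings gives their number. *)
rewrite /cluster_weight (big_distr_big_dep no_cluster) /=.
rewrite -(pair_big (linking P) (mem (pfamily no_cluster (mem P) cluster_on))
  (fun e (f : clusters) => \prod_(B in P) x ^+ #|(f B).2|)) /=.
by rewrite sumr_const mulr_natl.
Qed.

End Weights.

End Clusters.

(** * Transport of clusters along an injection of vertex sets *)

Section Transport.

Variables (k : nat) (U V : finType) (h : U -> V).
Variables (okU : pred (k.+1.-tuple U)) (okV : pred (k.+1.-tuple V)).
Hypothesis h_inj : injective h.
Hypothesis h_ok : forall t, okV (map_tuple h t) = okU t.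

Local Notation clusterU := ({ffun U -> option U} * {set k.+1.-tuple U})%type.
Local Notation clusterV := ({ffun V -> option V} * {set k.+1.-tuple V})%type.
Local Notation hT := (h @: [set: U]).

Let pre v := [pick u | h u == v].

Let pre_h u : pre (h u) = Some u.
Proof.
rewrite /pre; case: pickP => [w /eqP/h_inj-> //|/(_ u)].
by rewrite eqxx.
Qed.

Let in_hT u : h u \in hT. Proof. by rewrite imset_f ?inE. Qed.

Definition push_map (q : {ffun U -> option U}) : {ffun V -> option V} :=
  [ffun v => obind (fun u => omap h (q u)) [pick u | h u == v]].

Definition push (c : clusterU) : clusterV :=
  (push_map c.1, map_tuple h @: c.2).

Definition pull (c : clusterV) : clusterU :=
  ([ffun u => obind (fun v => [pick u | h u == v]) (c.1 (h u))],
   map_tuple h @^-1: c.2).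

Lemma push_map_h q u : push_map q (h u) = omap h (q u).
Proof. by rewrite ffunE -/(pre (h u)) pre_h. Qed.

Lemma push_map_out q v : v \notin hT -> push_map q v = None.
Proof. by rewrite ffunE; case: pickP => //= u /eqP <-; rewrite in_hT. Qed.

Let map_h_inj : injective (map_tuple h : k.+1.-tuple U -> k.+1.-tuple V).
Proof. by move=> s t /(congr1 val)/(inj_map h_inj)/val_inj. Qed.

Lemma pushK : cancel push pull.
Proof.
case=> q H; congr pair.
  apply/ffunP => u; rewrite ffunE /= push_map_h.
  by case: (q u) => //= w; apply: pre_h.
by apply/setP => t; rewrite inE mem_imset.
Qed.

(** [pull] forgets edges and marks outside the image of [h]; a cluster on the image has none. *)
Lemma pullK c : cluster_on okV hT c -> push (pull c) = c.
Proof.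
case: c => q H /and5P[_ /supportedP/= sq _ _ /andP[/forall_inP/= HT _]].
congr pair.
  apply/ffunP => v; case: (boolP (v \in hT)) => [/imsetP[u _ ->]|vT].
    rewrite push_map_h ffunE /=; case E: (q (h u)) => [w|] //=.
    by have [_ /imsetP[z _ ->]] := sq _ _ E; rewrite -/(pre (h z)) pre_h.
  rewrite push_map_out //; case E: (q v) => [w|] //.
  by case: (sq _ _ E) vT => ->.
apply/setP => t; apply/imsetP/idP => [[s + ->]|tH]; first by rewrite inE.
have tT i : exists u, h u == tnth t i.
  have /imsetP[u _ ->] := subsetP (HT t tH) _ (mem_tnth i t).
  by exists u.
have tE : t = map_tuple h [tuple xchoose (tT i) | i < k.+1].
  apply: eq_from_tnth => i; rewrite tnth_map tnth_mktuple.
  exact/esym/eqP/(xchooseP (tT i)).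
by rewrite tE in tH *; eexists; last reflexivity; rewrite inE.
Qed.

Lemma map_tuple_subset (t : k.+1.-tuple U) (A : {set V}) :
  (map_tuple h t \subset A) = (t \subset h @^-1: A).
Proof.
apply/subsetP/subsetP => tA u ut; first by rewrite inE tA ?map_f.
by case/mapP: ut => w /tA; rewrite inE => ? ->.
Qed.

Lemma preimset_hC (A : {set V}) : h @^-1: (~: A) = ~: (h @^-1: A).
Proof. by apply/setP => u; rewrite !inE. Qed.

Lemma preimset_hK (A : {set U}) : h @^-1: (h @: A) = A.
Proof. by apply/setP => u; rewrite inE mem_imset. Qed.

Lemma respects_push (H : {set k.+1.-tuple U}) (A : {set V}) :
  respects (map_tuple h @: H) A = respects H (h @^-1: A).
Proof.
apply/forall_inP/forall_inP => rA t.
  by move=> tH; rewrite -preimset_hC -!map_tuple_subset rA ?imset_f.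
by case/imsetP => s /rA sA ->; rewrite !map_tuple_subset preimset_hC.
Qed.

Lemma connected_push (H : {set k.+1.-tuple U}) :
  connected (map_tuple h @: H) hT = connected H setT.
Proof.
have hS (A : {set V}) : (hT \subset A) = ([set: U] \subset h @^-1: A).
  apply/subsetP/subsetP => [hA u _|hA v /imsetP[u _ ->]].
    by rewrite inE hA.
  by have := hA u; rewrite !inE => ->.
apply/forallP/forallP => cH A; last first.
  by rewrite respects_push !hS preimset_hC.
(* A cut of [U] is tested through its image, whose preimage is the cut again by injectivity. *)
by have := cH (h @: A); rewrite respects_push !hS preimset_hC preimset_hK.
Qed.

Lemma acyclic_push q : acyclic (push_map q) = acyclic q.
Proof.
apply/acyclicP/acyclicP => acq S /set0Pn[v vS].
  have [|w /imsetP[u uS ->]] := acq (h @: S).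
    by apply/set0Pn; exists (h v); apply: imset_f.
  rewrite push_map_h => qu; exists u => //.
  by case: (q u) qu => //= z; rewrite mem_imset.
case: (boolP (v \in hT)) => [/imsetP[u _ vE]|vT]; last first.
  by exists v; rewrite // push_map_out.
have [|w] := acq (h @^-1: S); first by apply/set0Pn; exists u; rewrite inE -vE.
rewrite inE => wS qw; exists (h w) => //.
by rewrite push_map_h; case: (q w) qw => //= z; rewrite inE.
Qed.

Lemma occurrences_push q t :
  (map_tuple h t \in occurrences okV (push_map q)) = (t \in occurrences okU q).
Proof.
rewrite !inE h_ok; congr andb; apply/chainP/chainP => cq i j ij.
  have := cq i j ij; rewrite !tnth_map push_map_h.
  by case: (q _) => //= z [/h_inj->].
by rewrite !tnth_map push_map_h (cq i j ij).
Qed.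

Lemma cluster_push c :
  cluster_on okV hT (push c) = cluster_on okU setT c.
Proof.
case: c => q H; rewrite /cluster_on /= acyclic_push connected_push.
have -> : (hT != set0) = ([set: U] != set0).
  apply/set0Pn/set0Pn => [[_ /imsetP[u _ _]]|[u _]].
    by exists u; rewrite inE.
  by exists (h u).
have -> : supported (push_map q) hT.
  apply/supportedP => w v; case: (boolP (v \in hT)) => [/imsetP[u _ ->]|vT].
    by rewrite push_map_h; case: (q u) => //= z [<-].
  by rewrite push_map_out.
have -> : supported q setT by apply/supportedP => u v _; rewrite !inE.
have -> : [forall t in map_tuple h @: H, t \subset hT].
  apply/forall_inP => _ /imsetP[t _ ->]; rewrite map_tuple_subset.
  by apply/subsetP => u _; rewrite inE.
have -> : [forall t in H, t \subset [set: U]].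
  by apply/forall_inP => t _; apply/subsetP => u _; rewrite inE.
do 3!congr andb; congr andb; apply/subsetP/subsetP => HO t.
  by move=> tH; rewrite -occurrences_push HO ?imset_f.
by case/imsetP => s sH ->; rewrite occurrences_push HO.
Qed.

Lemma cluster_weight_transport (R : comNzRingType) (x : R) :
  cluster_weight okV x hT = cluster_weight okU x setT.
Proof.
rewrite /cluster_weight (reindex_onto push pull pullK) /=.
apply: eq_big => [c|c _]; first by rewrite cluster_push pushK eqxx andbT.
by rewrite card_imset.
Qed.

End Transport.

(** * Patterns as order conditions on labels *)

Section Patterns.

Variables (k : nat) (sigma : 'S_k.+1).

Definition order_isomorphic (n : nat) (t : k.+1.-tuple 'I_n) : bool :=
  [forall i : 'I_k.+1, forall j : 'I_k.+1,
     (tnth t i < tnth t j) == (sigma i < sigma j)].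

(** [enum B] is filtered from the increasing list of all labels, hence increasing. *)
Lemma enum_val_mono (n : nat) (B : {set 'I_n}) (i j : 'I_#|B|) :
  (enum_val i < enum_val j) = (i < j).
Proof.
have sB : sorted (relpre val ltn) (enum B).
  apply: sorted_filter; first by move=> x y z; apply: ltn_trans.
  by rewrite -enumT -sorted_map val_enum_ord iota_ltn_sorted.
have homo (a b : 'I_#|B|) : a < b -> enum_val a < enum_val b.
  move=> ab.
  rewrite (enum_val_nth (enum_val a) b) {1}(enum_val_nth (enum_val a) a).
  by apply: (sorted_ltn_nth _ _ sB) => //; rewrite ?inE -?cardE //;
    move=> x y z; apply: ltn_trans.
case: (ltngtP i j) => [/homo//|/homo ji|/val_inj->]; last by rewrite ltnn.
by rewrite ltnNge ltnW.
Qed.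

Lemma order_isomorphic_map (m n : nat) (h : 'I_m -> 'I_n) t :
  (forall i j, (h i < h j) = (i < j)) ->
  order_isomorphic (map_tuple h t) = order_isomorphic t.
Proof.
move=> hm; apply: eq_forallb => i; apply: eq_forallb => j.
by rewrite !tnth_map hm.
Qed.

(** Standardisation: [enum_val] relabels [B] monotonically and so preserves instances of the
    pattern. *)
Lemma cluster_weight_card (R : comNzRingType) (x : R) (n : nat)
    (B : {set 'I_n}) :
  cluster_weight (@order_isomorphic n) x B =
  cluster_weight (@order_isomorphic #|B|) x setT.
Proof.
have BE : enum_val @: [set: 'I_#|B|] = B.
  apply/setP => v; apply/imsetP/idP => [[i _ ->]|vB]; first exact: enum_valP.
  by exists (enum_rank_in vB v); rewrite ?inE ?enum_rankK_in.
rewrite -{1}BE; apply: cluster_weight_transport => [|t].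
  exact: enum_val_inj.
by apply: order_isomorphic_map => i j; apply: enum_val_mono.
Qed.

(** [cluster_on] mentions neither a single root nor coverage. The root comes from [cluster_root].
    For coverage, an uncovered vertex alone would be a compatible cut, hence the only vertex; but
    some mark exists as [0 < m], and it contains that vertex. *)
Lemma forest_clusterE (n m : nat) (p : parent_map n) H : 0 < n -> 0 < m ->
  is_forest_cluster sigma m p H =
  cluster_on (@order_isomorphic n) setT (p, H) && (#|H| == m).
Proof.
move=> n0 m0; have v0 : 'I_n by exists 0.
apply/and5P/andP => [[/andP[Fp _] Hp Hm _ sp]|[cl Hm]].
  split=> //; apply/and5P; split=> //=.
  - by apply/set0Pn; exists v0.
  - by apply/supportedP => u v _; rewrite !inE.
  - by rewrite -is_forestE.
  rewrite (_ : [forall t in H, _] = true) /=; last first.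
    by apply/forall_inP => t _; apply/subsetP => v _; rewrite inE.
  apply/connectedP => A rA; case: (eqVneq A set0) => [->|A0].
    by right; rewrite setC0.
  case: (eqVneq (~: A) set0) => [A0'|A0']; last first.
    by case/existsP: sp; exists A; apply/and3P.
  by left; rewrite -setCS A0' sub0set.
have [r _ rr] := cluster_root cl.
have /and5P[/= _ _ acp Hp /andP[_ /connectedP cH]] := cl.
split=> //.
- rewrite /is_tree is_forestE acp /= -(cards1 r); apply/eqP.
  congr #|pred_of_set _|.
  by apply/setP => v; rewrite !inE rr ?inE.
- apply/forallP => v; apply: contraT => /exists_inPn vH.
  have [||/subsetP/(_ v)] := cH [set v]; last by rewrite !inE eqxx => /(_ isT).
    apply/forall_inP => t /vH vt; apply/orP; right; apply/subsetP => u ut.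
    by rewrite !inE; apply: contraNneq vt => <-.
  have /card_gt0P[t tH] : 0 < #|H| by rewrite (eqP Hm).
  move/subsetP/(_ (tnth t ord0)); rewrite !inE => /(_ isT)/eqP tv.
  by have := vH t tH; rewrite -tv mem_tnth.
- apply/negP => /existsP[A /and3P[/set0Pn[u uA] /set0Pn[v vA] /cH[]]].
    by move/subsetP/(_ v); move: vA; rewrite !inE => /negPf-> /(_ isT).
  by move/subsetP/(_ u); rewrite !inE uA => /(_ isT).
Qed.

(** The path spelling [sigma] from the root down: [i] is the position of label [v]. *)
Definition pattern_path : parent_map k.+1 :=
  [ffun v => let i := (sigma^-1)%g v in
             if i == ord0 then None else Some (sigma (inord i.-1))].

Lemma path_cluster :
  cluster_on (@order_isomorphic k.+1) setT
    (pattern_path, [set [tuple sigma i | i < k.+1]]).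
Proof.
set t := mktuple _; have tv v : v \in t.
  by apply/tnthP; exists ((sigma^-1)%g v); rewrite tnth_mktuple permKV.
apply/and5P; split=> /=.
- by apply/set0Pn; exists ord0.
- by apply/supportedP => u v _; rewrite !inE.
- apply/acyclicP => S /set0Pn[v0 v0S].
  (* The vertex of [S] nearest to the root has its parent, if any, outside [S]. *)
  have [v vS vmin] := arg_minnP (fun v => (sigma^-1)%g v : nat) v0S.
  exists v => //; rewrite ffunE /=; case: eqP => //= v1; apply/negP => /vmin.
  have iv : 0 < (sigma^-1)%g v.
    by rewrite lt0n; apply/eqP => i0; apply/v1/val_inj.
  rewrite permK inordK; last by rewrite (leq_ltn_trans (leq_pred _)).
  by rewrite leqNgt prednK ?leqnn.
- apply/subsetP => s; rewrite !inE => /eqP->; apply/andP; split; last first.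
    by apply/forallP => i; apply/forallP => j; rewrite !tnth_mktuple.
  apply/chainP => i j ij; rewrite !tnth_mktuple ffunE /= permK.
  case: eqP => [j0|_]; first by rewrite j0 in ij.
  by rewrite ij /= inord_val.
apply/andP; split.
  by apply/forall_inP => s _; apply/subsetP => v; rewrite inE.
apply/connectedP => A /forall_inP/(_ t (set11 t))/orP.
by case=> /subsetP tA; [left|right]; apply/subsetP => v _; apply: tA.
Qed.

(** * Polynomials counting clusters by marks and forests by instances *)

Local Open Scope ring_scope.

Definition cluster_poly (n : nat) : {poly int} :=
  cluster_weight (@order_isomorphic n) 'X setT.

Definition forest_poly (n : nat) : {poly int} :=
  \sum_(p : parent_map n | is_forest p) 'X^#|instances sigma p|.

Lemma coef_sum_expX (T : finType) (P : pred T) (f : T -> nat) (m : nat) :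
  (\sum_(c | P c) 'X^(f c) : {poly int})`_m = #|[set c | P c & f c == m]|%:R.
Proof.
rewrite coef_sum -sum1dep_card natr_sum big_mkcondr /=.
by apply: eq_bigr => c _; rewrite coefXn eq_sym; case: eqP.
Qed.

Lemma coef_forest_poly n m : (forest_poly n)`_m = (num_forests sigma n m)%:R.
Proof. exact: coef_sum_expX. Qed.

Lemma coef_cluster_poly n m : (0 < n)%N -> (0 < m)%N ->
  (cluster_poly n)`_m = (forest_cluster_number sigma n m)%:R.
Proof.
move=> n0 m0; rewrite coef_sum_expX; congr _%:R; apply: eq_card => -[p H].
by rewrite !inE forest_clusterE.
Qed.

(* Clusters without marks exist only on one vertex; it is enough to know that
   their number does not depend on the pattern. *)
Lemma coef0_cluster_poly n : (0 < n)%N ->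
  (cluster_poly n)`_0 =
  #|[set q : parent_map n | acyclic q &
     [forall A : {set 'I_n}, (setT \subset A) || (setT \subset ~: A)]]|%:R.
Proof.
move=> n0; rewrite coef_sum_expX; congr _%:R.
rewrite -(card_imset _ (_ : injective (fun q : parent_map n =>
  (q, set0 : {set k.+1.-tuple 'I_n})))); last by move=> p q [].
apply: eq_card => -[p H]; rewrite inE /= cards_eq0.
apply/andP/imsetP => [[cl /eqP H0]|[q + [-> ->]]].
  exists p; last by rewrite H0.
  move: cl; rewrite H0 inE => /and5P[_ _ -> _ /andP[_ /connectedP cl]] /=.
  apply/forallP => A; apply/orP/cl.
  by apply/forall_inP => t; rewrite inE.
rewrite inE => /andP[acq /forallP cA]; split=> //.
apply/and5P; split; rewrite ?sub0set //=.
- by apply/set0Pn; exists (Ordinal n0).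
- by apply/supportedP => u v _; rewrite !inE.
apply/andP; split; first by apply/forall_inP => t; rewrite inE.
by apply/connectedP => A _; apply/orP/cA.
Qed.

(** Substituting ['X + 1] turns instances into choices of marks; the block expansion then applies
    with [x = 'X]. *)
Lemma forest_poly_blocks n :
  forest_poly n \Po ('X + 1%:P) =
  \sum_(P : {set {set 'I_n}} | partition P setT)
     #|linking P|%:R * \prod_(B in P) cluster_poly #|B|.
Proof.
rewrite -(eq_bigr _ (fun P _ => congr1 _ (eq_bigr _ (fun B _ =>
  cluster_weight_card 'X B)))).
rewrite -sum_forests_blocks /forest_poly raddf_sum /=.
apply: eq_big => [p|p _]; first by rewrite is_forestE.
by rewrite comp_Xn_poly addrC.
Qed.

End Patterns.

(** * Forest polynomials and cluster polynomials determine each other *)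

Section Equivalence.

Local Open Scope ring_scope.

Variables (k l : nat) (sigma : 'S_k.+1) (tau : 'S_l.+1).

Lemma forest_poly_eqP :
  strong_c_forest_Wilf_equivalent sigma tau <->
  (forall n, forest_poly sigma n = forest_poly tau n).
Proof.
split=> [eqW n|eqF n m].
  by apply/polyP => m; rewrite !coef_forest_poly eqW.
have := congr1 (fun p : {poly int} => p`_m) (eqF n).
by rewrite !coef_forest_poly => /eqP; rewrite eqr_nat => /eqP.
Qed.

Lemma cluster_poly_eqP :
  (forall n m : nat, (1 <= n)%N -> (1 <= m)%N ->
     forest_cluster_number sigma n m = forest_cluster_number tau n m) <->
  (forall n, (0 < n)%N -> cluster_poly sigma n = cluster_poly tau n).
Proof.
split=> [eqr n n0|eqC n m n0 m0].
  apply/polyP => -[|m]; first by rewrite !coef0_cluster_poly.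
  by rewrite !coef_cluster_poly // eqr.
have := congr1 (fun p : {poly int} => p`_m) (eqC n n0).
by rewrite !coef_cluster_poly // => /eqP; rewrite eqr_nat => /eqP.
Qed.

(** The coefficient of the one-block term must be nonzero to be cancelled; leaving the block
    unlinked is a linking. *)
Lemma linking_setT (V : finType) : (0 < #|@linking V [set setT]|)%N.
Proof.
apply/card_gt0P; exists [ffun=> None]; apply/linkingP.
split=> [B _|D _ /set0Pn[B BD]]; first by rewrite ffunE.
by exists B; rewrite ?ffunE.
Qed.

Lemma forest_poly_eq_cluster_poly :
  (forall n, forest_poly sigma n = forest_poly tau n) <->
  (forall n, (0 < n)%N -> cluster_poly sigma n = cluster_poly tau n).
Proof.
have block_gt0 n (P : {set {set 'I_n}}) B :
    partition P setT -> B \in P -> (0 < #|B|)%N.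
  move=> pP BP; rewrite card_gt0; apply: contraTneq BP => ->.
  by case/and3P: pP.
split=> [eqF n|eqC n]; last first.
  (* The substitution of ['X + 1] is undone by ['X - 1], so comparing shifted polynomials
     suffices. *)
  rewrite -[LHS](comp_polyXaddC_K _ 1) -[RHS](comp_polyXaddC_K _ 1).
  rewrite !forest_poly_blocks; congr (_ \Po _); apply: eq_bigr => P pP.
  congr (_ * _); apply: eq_bigr => B BP.
  by rewrite eqC // (block_gt0 _ _ _ pP BP).
elim/ltn_ind: n => n IHn n0.
have := congr1 (comp_poly ('X + 1%:P)) (eqF n); rewrite !forest_poly_blocks.
have pT : partition [set [set: 'I_n]] setT.
  apply/and3P; split; first by rewrite /cover big_set1.
    by apply/trivIsetP => A B; rewrite !inE => /eqP-> /eqP->; rewrite eqxx.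
  by rewrite inE eq_sym; apply/set0Pn; exists (Ordinal n0).
rewrite (bigD1 [set [set: 'I_n]]) //=.
rewrite [RHS](bigD1 [set [set: 'I_n]]) //= !big_set1 cardsT card_ord.
set rest := (X in _ + X = _ + _); set rest' := (X in _ + _ = _ + X).
(* A part equal to the whole set would be the only part. In every other partition all blocks are
   therefore proper and fall under the induction hypothesis. *)
have -> : rest = rest'.
  apply: eq_bigr => P /andP[pP nP]; congr (_ * _); apply: eq_bigr => B BP.
  apply: IHn; last exact: block_gt0 pP BP.
  suff /proper_card : B \proper [set: 'I_n] by rewrite cardsT card_ord.
  rewrite properT; apply: contraNneq nP => BT; rewrite BT in BP.
  rewrite eqEsubset sub1set BP andbT; apply/subsetP => C CP; rewrite inE.
  have /set0Pn[v vC] : C != set0 by rewrite -card_gt0 (block_gt0 _ _ _ pP CP).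
  by rewrite -(block_pblock pP CP vC) (block_pblock pP BP) ?inE.
move/addIr/mulfI; apply.
by rewrite -polyC_natr polyC_eq0 pnatr_eq0 -lt0n linking_setT.
Qed.

Lemma equivalent_iff_clusters :
  strong_c_forest_Wilf_equivalent sigma tau <->
  (forall n m : nat, (1 <= n)%N -> (1 <= m)%N ->
     forest_cluster_number sigma n m = forest_cluster_number tau n m).
Proof.
apply: (iff_trans forest_poly_eqP).
apply: (iff_trans forest_poly_eq_cluster_poly).
exact: iff_sym cluster_poly_eqP.
Qed.

End Equivalence.

(* The empty pattern lies outside the decomposition: its unique instance, the
   empty tuple, occurs in every forest but belongs to no block. *)
Section EmptyPattern.

(** The empty forest contains the empty tuple, an instance of the empty pattern, but no instance of
    a longer one. This separates the two kinds of pattern. *)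
Lemma num_forests_empty (k : nat) (sigma : 'S_k) :
  num_forests sigma 0 0 = (0 < k).
Proof.
case: k sigma => [|k] sigma /=.
  apply: eq_card0 => p; rewrite inE -leqn0; apply/negP => /andP[_].
  rewrite leqNgt => /negP[]; apply/card_gt0P; exists [tuple].
  by rewrite inE; apply/andP; split; apply/forallP => -[].
apply/eqP; rewrite eqn_leq; apply/andP; split.
  apply: leq_trans (max_card _) _.
  by rewrite card_ffun card_option !card_ord.
apply/card_gt0P; exists [ffun=> None]; rewrite inE; apply/andP; split.
  by apply/forallP => -[].
by rewrite cards_eq0; apply/eqP/setP => t; case: (tnth t ord0).
Qed.

(** An empty instance covers no vertex. *)
Lemma forest_cluster_number_empty (sigma : 'S_0) (n m : nat) : 0 < n ->
  forest_cluster_number sigma n m = 0.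
Proof.
move=> n0; apply: eq_card0 => -[p H]; rewrite inE.
apply/negP => /and5P[_ _ _ /forallP/(_ (Ordinal n0))/exists_inP[t _ vt] _].
by rewrite tuple0 in vt.
Qed.

Lemma forest_cluster_number_path (k : nat) (sigma : 'S_k.+1) :
  0 < forest_cluster_number sigma k.+1 1.
Proof.
apply/card_gt0P; exists (pattern_path sigma, [set [tuple sigma i | i < k.+1]]).
by rewrite inE forest_clusterE // path_cluster cards1.
Qed.

Lemma empty_not_equivalent (k : nat) (sigma : 'S_0) (tau : 'S_k.+1) :
  ~ strong_c_forest_Wilf_equivalent sigma tau.
Proof. by move/(_ 0 0); rewrite !num_forests_empty. Qed.

Lemma empty_clusters_differ (k : nat) (sigma : 'S_0) (tau : 'S_k.+1) :
  ~ (forall n m : nat, 1 <= n -> 1 <= m ->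
       forest_cluster_number sigma n m = forest_cluster_number tau n m).
Proof.
move/(_ k.+1 1 isT isT); rewrite forest_cluster_number_empty // => E.
by have := forest_cluster_number_path tau; rewrite -E.
Qed.

End EmptyPattern.

Theorem theorem6p2 (k l : nat) (sigma : 'S_k) (tau : 'S_l) :
  strong_c_forest_Wilf_equivalent sigma tau <->
  (forall n m : nat, 1 <= n -> 1 <= m ->
     forest_cluster_number sigma n m = forest_cluster_number tau n m).
Proof.
(* Two empty patterns coincide; if exactly one is empty, both sides of the equivalence fail. *)
case: k l sigma tau => [|k] [|l] sigma tau.
- by have -> : sigma = tau by apply/permP => -[].
- by split=> [/empty_not_equivalent|/empty_clusters_differ].
- split=> [E|E]; first by case: (@empty_not_equivalent _ tau sigma) => n m.
  by case: (@empty_clusters_differ _ tau sigma) => n m n0 m0; rewrite E.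
- exact: equivalent_iff_clusters.
Qed.
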